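(* Let $n\ge 5$ and let $K$ be an arbitrary field. Let $L$ be the field of cross-ratios over $K$, i.e. the subfield of $K(x_1,\ldots,x_n)$ generated over $K$ by all cross-ratios $[i,j;k,l]$ with $i,j,k,l$ four distinct elements of $\{1,\ldots,n\}$. Then $L$ is a faithful $S_n$-subfield of $K(x_1,\ldots,x_n)$. Moreover, $L=K([1,2;3,i]:4\le i\le n)$ is purely transcendental of degree $n-3$ over $K$.
   Context: $K(x_1,\ldots,x_n)$ is the rational function field in $n$ variables over $K$, on which the symmetric group $S_n$ acts by $K$-automorphisms with $\sigma\cdot x_i=x_{\sigma(i)}$. For four distinct elements $i,j,k,l$ of $\{1,\ldots,n\}$ the cross-ratio is $$[i,j;k,l]=(x_i-x_k)(x_j-x_l)(x_i-x_l)^{-1}(x_j-x_k)^{-1}\in K(x_1,\ldots,x_n).$$ For a finite group $G$ acting on a field $M\supset K$ by $K$-automorphisms, an intermediate field $K\subset E\subset M$ is a $G$-subfield if $\sigma(E)\subset E$ for all $\sigma\in G$; it is a faithful $G$-subfield if moreover every non-identity element of $G$ restricts to a non-identity map on $E$. *)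

(* Defs.v *)
From HB Require Import structures.
From mathcomp Require Import all_boot all_fingroup all_algebra.
From mathcomp Require Import boolp classical_sets.
From mathcomp Require Import generic_quotient mpoly.

Set Implicit Arguments.
Unset Strict Implicit.
Unset Printing Implicit Defensive.

Import GRing.Theory.
Local Open Scope classical_set_scope.
Local Open Scope ring_scope.
Local Open Scope quotient_scope.

(** Subfields of an extension [iota : K -> M], as Prop-valued sets since
    membership in a generated subfield is not decidable. *)

Section Subfields.
Context (K M : fieldType) (iota : {rmorphism K -> M}).
Implicit Types (E S : set M).

(* Prop-valued [divring_closed]; [0] and [1] come from [range iota], and
   closure under [x / 0 = 0] is harmless. *)
Definition intermediate_field E : Prop :=
  [/\ range iota `<=` E,
      forall x y, E x -> E y -> E (x - y)
    & forall x y, E x -> E y -> E (x / y)].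

Definition adjoin S : set M := smallest intermediate_field S.

Lemma intermediate_field_adjoin S : intermediate_field (adjoin S).
Proof.
split=> [_ [c _ <-] E [[cE _ _] _]|x y xS yS E ES|x y xS yS E ES].
- by apply: cE; exists c.
- by have [[_ EB _] _] := ES; apply: EB; [apply: xS|apply: yS].
- by have [[_ _ ED] _] := ES; apply: ED; [apply: xS|apply: yS].
Qed.

Definition algebraically_independent d (t : 'I_d -> M) : Prop :=
  forall p : {mpoly K[d]}, mmap iota t p = 0 -> p = 0.

Definition purely_transcendental E (d : nat) : Prop :=
  exists t : 'I_d -> M, algebraically_independent t /\ E = adjoin (range t).

Context (gT : finGroupType) (to : {action gT &-> M}).

Definition acts_by_automorphisms : Prop :=
  forall s, [/\ zmod_morphism (to^~ s), monoid_morphism (to^~ s)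
              & forall c, to (iota c) s = iota c].

Definition G_subfield E : Prop :=
  intermediate_field E /\ forall s : gT, [set to x s | x in E] `<=` E.

Definition faithful_G_subfield E : Prop :=
  G_subfield E /\
  forall s : gT, s != 1%g -> exists2 x, E x & to x s <> x.

End Subfields.

Section RationalFunctions.
Context (K : fieldType) (n : nat).

Local Notation ratfun := {fraction {mpoly K[n]}}.
Local Notation "p %:F" := (@FracField.tofrac {mpoly K[n]} p).

Definition ratC : {rmorphism K -> ratfun} :=
  @FracField.tofrac {mpoly K[n]} \o @mpolyC n K.

Definition ratX (i : 'I_n) : ratfun := ('X_i)%:F.

Lemma ratfunP (f : ratfun) :
  exists p q : {mpoly K[n]}, q != 0 /\ f = p%:F / q%:F.
Proof.
elim/quotW: f => r; exists \n_r, \d_r; have dr := denom_ratioP r.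
split=> //; have dF : (\d_r)%:F != 0 by rewrite tofrac_eq0.
apply: (mulIf dF).
rewrite divfK ?tofrac_eq0 // /FracField.tofrac; unlock => /=.
rewrite -[LHS]FracField.pi_mul; apply/eqmodP.
by rewrite /= FracField.equivfE /FracField.mulf !numden_Ratio
  ?mulf_neq0 ?oner_neq0 // !mulr1 mulrC.
Qed.

(* Defined on a chosen representative [p / q]; [ratsym_frac] shows that the
   choice is immaterial. *)
Definition ratsym (f : ratfun) (s : 'S_n) : ratfun :=
  (msym s \n_(repr f))%:F / (msym s \d_(repr f))%:F.

Lemma msym_neq0 (q : {mpoly K[n]}) s : q != 0 -> msym s q != 0.
Proof.
by apply: contraNneq => q0; apply/eqP/(@inj_msym n K s); rewrite q0 msym0.
Qed.

Lemma ratsym_frac (p q : {mpoly K[n]}) s : q != 0 ->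
  ratsym (p%:F / q%:F) s = (msym s p)%:F / (msym s q)%:F.
Proof.
move=> q0; rewrite /ratsym; set f := p%:F / q%:F; set r := repr f.
have dr : \d_r != 0 := denom_ratioP r.
have fr : f * (\d_r)%:F = (\n_r)%:F.
  rewrite -[f in LHS]reprK -/r /FracField.tofrac; unlock => /=.
  rewrite -[LHS]FracField.pi_mul; apply/eqmodP.
  by rewrite /= FracField.equivfE /FracField.mulf !numden_Ratio
    ?mulf_neq0 ?oner_neq0 // !mulr1 mulrC.
have e : p * \d_r = \n_r * q.
  apply/eqP; rewrite -tofrac_eq !tofracM -fr mulrAC /f divfK //.
  by rewrite tofrac_eq0.
apply/eqP; rewrite eqr_div ?tofrac_eq0 ?msym_neq0 //.
by rewrite -!tofracM -!msymM e.
Qed.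

Lemma ratsym_tofrac (p : {mpoly K[n]}) s : ratsym p%:F s = (msym s p)%:F.
Proof.
rewrite -[p%:F]divr1 -tofrac1 ratsym_frac ?oner_neq0 //.
by rewrite msym1 tofrac1 divr1.
Qed.

Lemma ratsym1 : ratsym^~ 1%g =1 id.
Proof.
by move=> f; have [p [q [q0 ->]]] := ratfunP f; rewrite ratsym_frac // !msym1m.
Qed.

Lemma ratsymM f : act_morph ratsym f.
Proof.
move=> s t; have [p [q [q0 ->]]] := ratfunP f.
by rewrite !ratsym_frac ?msym_neq0 // !msymMm.
Qed.

(* A right action, as [*] in ['S_n] composes from left to right, that is
   [(s * t) i = t (s i)]. *)
Definition rat_action : {action 'S_n &-> ratfun} := TotalAction ratsym1 ratsymM.

Lemma rat_actionX i s : rat_action (ratX i) s = ratX (s i).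
Proof.
rewrite /= ratsym_tofrac msymX; congr (_%:F); congr ('X_[_]).
apply/mnmP=> j; rewrite mnmE !mnm1E.
by rewrite -(inj_eq (@perm_inj _ s)) permKV.
Qed.

Lemma rat_action_automorphisms : acts_by_automorphisms ratC rat_action.
Proof.
move=> s; split=> [f g||c] /=.
- have [p [q [q0 ->]]] := ratfunP f; have [p' [q' [q'0 ->]]] := ratfunP g.
  have F0 (u : {mpoly K[n]}) : u != 0 -> u%:F != 0 by rewrite tofrac_eq0.
  rewrite -mulNr addf_div ?F0 // -tofracN -!tofracM -tofracD.
  rewrite !ratsym_frac ?mulf_neq0 // -mulNr addf_div ?F0 ?msym_neq0 //.
  by rewrite -tofracN -!tofracM -tofracD msymD !msymM msymN.
- split=> [|f g]; first by rewrite -tofrac1 ratsym_tofrac msym1.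
  have [p [q [q0 ->]]] := ratfunP f; have [p' [q' [q'0 ->]]] := ratfunP g.
  rewrite mulf_div -!tofracM !ratsym_frac ?mulf_neq0 // mulf_div.
  by rewrite !msymM !tofracM.
- by rewrite ratsym_tofrac -[c%:MP]mulr1 mul_mpolyC msymZ msym1.
Qed.

Definition cross_ratio (i j k l : 'I_n) : ratfun :=
  (ratX i - ratX k) * (ratX j - ratX l)
    * (ratX i - ratX l)^-1 * (ratX j - ratX k)^-1.

Definition cross_ratio_field : set ratfun :=
  adjoin ratC [set z | exists i j k l : 'I_n,
    uniq [:: i; j; k; l] /\ z = cross_ratio i j k l].

End RationalFunctions.

Arguments ratC : clear implicits.
Arguments rat_action : clear implicits.
Arguments cross_ratio_field : clear implicits.

(* Main.v *)
Require Import Defs.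
From mathcomp Require Import all_boot all_fingroup all_algebra.
From mathcomp Require Import boolp classical_sets.
From mathcomp Require Import mpoly.
From HB Require Import structures.
From mathcomp Require Import ring.

Set Implicit Arguments.
Unset Strict Implicit.
Unset Printing Implicit Defensive.

Local Open Scope classical_set_scope.
Local Open Scope ring_scope.

(** The cross-ratio of four points of a line is invariant under fractional
    linear maps.  Write 0, 1, 2 for the first three indices.  As a function of
    [x_i], the cross-ratio [t_i = [0, 1; 2, i]] is the fractional linear map
    that sends [x_0, x_1, x_2] to infinity, 0 and 1.  By invariance,
    [[i, j; k, l]] is therefore the cross-ratio of the four points
    [t_i, t_j, t_k, t_l], where [t_0] is infinity, [t_1 = 0] and [t_2 = 1]; it
    is a rational function of the [t_i] with [i >= 3], so these generate the
    field ([cross_ratio_field_frame]).  Homogeneous coordinates, in which a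
    cross-ratio is a quotient of 2 x 2 determinants, treat the point at infinity
    like the others ([cross_frame_det]).

    The remaining two claims specialize the variables, which is legitimate on
    the fractions whose denominator does not vanish ([specializes]).

    For independence, the variables are sent to points whose cross-ratios [t_i]
    are exactly the variables of a polynomial ring in [n - 3] variables.  A
    polynomial relation between the [t_i] then becomes a relation between
    variables, hence is trivial ([frame_cross_ratio_independent]).

    For faithfulness, let [s i <> i].  As [n >= 5], there are [j, k, l] such
    that [i, j, k, l] are distinct and none of them is [s i].  The image of
    [[i, j; k, l]] under [s] involves [x_(s i)], while [[i, j; k, l]] does not:
    setting [x_(s i) = x_(s k)] annihilates the former and leaves the latter,
    which is nonzero, unchanged ([cross_ratio_neq]). *)

Import GRing.Theory.

(** * Cross-ratios in homogeneous coordinates *)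

Section CrossRatio.
Variable F : fieldType.

Definition cross (a b c d : F) : F :=
  (a - c) * (b - d) * (a - d)^-1 * (b - c)^-1.

Section Frame.
Variables (I : eqType) (x : I -> F) (o u v : I).
Hypotheses (x_inj : injective x) (frame : uniq [:: o; u; v]).

(** Homogeneous coordinates of the image of [x i] under the fractional linear
    map that sends [x o], [x u], [x v] to infinity, 0 and 1. *)
Definition frame_coord i : F * F :=
  if i == o then (1, 0) else (cross (x o) (x u) (x v) (x i), 1).

Definition frame_det i k : F :=
  (frame_coord i).1 * (frame_coord k).2 - (frame_coord k).1 * (frame_coord i).2.

Let subx_neq0 i k : i != k -> x i - x k != 0.
Proof. by rewrite subr_eq0 (inj_eq x_inj). Qed.

Lemma frame_coord_u : frame_coord u = (0, 1).
Proof.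
move: frame; rewrite /= !inE negb_or => /and3P[/andP[ou _] _ _].
by rewrite /frame_coord eq_sym (negPf ou) /cross subrr mulr0 !mul0r.
Qed.

Lemma frame_coord_v : frame_coord v = (1, 1).
Proof.
move: frame; rewrite /= !inE negb_or => /and3P[/andP[ou ov] uv _].
rewrite /frame_coord eq_sym (negPf ov) /cross; congr (_, _).
by field; rewrite !subx_neq0.
Qed.

(** As [x i - x k] is the determinant of the coordinates [(x i, 1)] and
    [(x k, 1)], it gets multiplied by the determinant [m] of the linear map
    behind [frame_coord]; rescaling the homogeneous coordinates of the point [i]
    by [w i] contributes the other two factors. *)
Lemma frame_detE : exists (m : F) (w : I -> F),
  [/\ m != 0, forall i, w i != 0
    & forall i k, frame_det i k = m * w i * w k * (x i - x k)].
Proof.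
move: frame; rewrite /= !inE negb_or => /and3P[/andP[ou ov] uv _].
pose m := (x o - x v) / (x u - x v) * (x u - x o).
have m0 : m != 0.
  by rewrite !mulf_neq0 ?invr_eq0 ?subx_neq0 // eq_sym.
(* At infinity the choice of [w] is forced by [frame_det o k = 1]. *)
pose w i := if i == o then m^-1 else (x o - x i)^-1.
exists m, w; split=> // [i|i k].
  rewrite /w; case: (eqVneq i o) => io; rewrite invr_eq0 //.
  by rewrite subx_neq0 // eq_sym.
rewrite /frame_det /frame_coord /w /cross.
have [->|io] := eqVneq i o; have [->|ko] := eqVneq k o => /=.
- by rewrite !subrr !mulr0.
- by move: (m) m0 => r r0; field; rewrite r0 !subx_neq0 // eq_sym.
- by move: (m) m0 => r r0; field; rewrite r0 !subx_neq0 // eq_sym.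
- by rewrite /m; field; rewrite !subx_neq0 // eq_sym.
Qed.

(** Each of the four indices occurs once above and once below in the
    cross-ratio, so the factors of [frame_detE] cancel. *)
Lemma cross_frame_det i j k l : uniq [:: i; j; k; l] ->
  cross (x i) (x j) (x k) (x l) =
  frame_det i k * frame_det j l / frame_det i l / frame_det j k.
Proof.
rewrite /= !inE !negb_or => /and4P[/and3P[ij ik il] /andP[jk jl] kl _].
have [m [w [m0 w0 detE]]] := frame_detE; rewrite !detE /cross.
by field; rewrite m0 !w0 !subx_neq0.
Qed.

End Frame.
End CrossRatio.

Lemma rmorph_cross (F F' : fieldType) (f : {rmorphism F -> F'}) a b c d :
  f (cross a b c d) = cross (f a) (f b) (f c) (f d).
Proof. by rewrite /cross !rmorphM !fmorphV !rmorphB. Qed.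

(** * Generated subfields *)

Section Adjoin.
Variables (K M : fieldType) (iota : {rmorphism K -> M}).
Implicit Types E S : set M.

Lemma sub_adjoin S : S `<=` adjoin iota S.
Proof. exact: sub_gen_smallest. Qed.

Lemma adjoin_sub S E :
  intermediate_field iota E -> S `<=` E -> adjoin iota S `<=` E.
Proof. exact: smallest_sub. Qed.

Section Closure.
Variable E : set M.
Hypothesis fieldE : intermediate_field iota E.

Lemma intermediate_field0 : E 0.
Proof. by have [iE _ _] := fieldE; apply: iE; exists 0; rewrite ?rmorph0. Qed.

Lemma intermediate_field1 : E 1.
Proof. by have [iE _ _] := fieldE; apply: iE; exists 1; rewrite ?rmorph1. Qed.

Lemma intermediate_fieldB x y : E x -> E y -> E (x - y).
Proof. by have [_ EB _] := fieldE; apply: EB. Qed.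

Lemma intermediate_fieldV x : E x -> E x^-1.
Proof.
have [_ _ ED] := fieldE => Ex; rewrite -[x^-1]mul1r.
by apply: ED => //; apply: intermediate_field1.
Qed.

Lemma intermediate_fieldM x y : E x -> E y -> E (x * y).
Proof.
have [_ _ ED] := fieldE => Ex Ey; rewrite -[y]invrK.
by apply: ED => //; apply: intermediate_fieldV.
Qed.

End Closure.

Lemma adjoin_stable S (f : {rmorphism M -> M}) :
  (forall c, f (iota c) = iota c) -> (forall x, S x -> adjoin iota S (f x)) ->
  forall x, adjoin iota S x -> adjoin iota S (f x).
Proof.
move=> f_iota fS x; have [iS SB SD] := intermediate_field_adjoin iota S.
apply: (@adjoin_sub S [set y | adjoin iota S (f y)]) => //; split=> /=.
- by move=> _ [c _ <-] /=; rewrite f_iota; apply: iS; exists c.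
- by move=> y z Sy Sz; rewrite rmorphB; apply: SB.
- by move=> y z Sy Sz; rewrite rmorphM fmorphV; apply: SD.
Qed.

End Adjoin.

(** * Specialization of fractions *)

Lemma mmap_rmorph (K S : comNzRingType) d (g : {rmorphism {mpoly K[d]} -> S})
    (p : {mpoly K[d]}) :
  mmap (g \o @mpolyC d K) (fun k => g 'X_k) p = g p.
Proof.
rewrite {2}[p]mpolyE raddf_sum; apply: eq_bigr => m _ /=.
rewrite -mul_mpolyC rmorphM mpolyXE_id rmorph_prod; congr (_ * _).
by apply: eq_bigr => k _; rewrite rmorphXn.
Qed.

Section Specialization.
Variables (R : idomainType) (F : fieldType) (e : {rmorphism R -> F}).
Local Notation "p %:F" := (@FracField.tofrac R p).

(** The extension of [e] to the localization of [R] at the elements that [e]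
    does not annihilate, as a relation: it is the graph of a partial function
    ([specializes_inj]). *)
Definition specializes (f : {fraction R}) (z : F) : Prop :=
  exists p q, [/\ e q != 0, f = p%:F / q%:F & z = e p / e q].

Let nz q : e q != 0 -> q%:F != 0.
Proof. by rewrite tofrac_eq0; apply: contraNneq => ->; rewrite rmorph0. Qed.

Lemma specializes_inj f z z' : specializes f z -> specializes f z' -> z = z'.
Proof.
move=> [p [q [q0 -> ->]]] [p' [q' [q'0 E ->]]]; apply/eqP.
move/eqP: E; rewrite !eqr_div ?nz // -!tofracM tofrac_eq => /eqP E.
by rewrite -!rmorphM E.
Qed.

Lemma specializes_tofrac p : specializes p%:F (e p).
Proof.
by exists p, 1; rewrite rmorph1 oner_neq0 tofrac1 !divr1.
Qed.

Lemma specializesD f g y z :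
  specializes f y -> specializes g z -> specializes (f + g) (y + z).
Proof.
move=> [p [q [q0 -> ->]]] [p' [q' [q'0 -> ->]]].
exists (p * q' + p' * q), (q * q').
rewrite rmorphM mulf_neq0 // !addf_div ?nz // tofracD !tofracM.
by rewrite rmorphD !rmorphM.
Qed.

Lemma specializesM f g y z :
  specializes f y -> specializes g z -> specializes (f * g) (y * z).
Proof.
move=> [p [q [q0 -> ->]]] [p' [q' [q'0 -> ->]]].
by exists (p * p'), (q * q'); rewrite !rmorphM mulf_neq0 // !mulf_div.
Qed.

Lemma specializesN f y : specializes f y -> specializes (- f) (- y).
Proof.
move=> [p [q [q0 -> ->]]].
by exists (- p), q; rewrite !rmorphN !mulNr.
Qed.

Lemma specializesV f y : y != 0 -> specializes f y -> specializes f^-1 y^-1.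
Proof.
move=> y0 [p [q [q0 -> E]]]; exists q, p; rewrite E !invf_div; split=> //.
by apply: contraNneq y0 => p0; rewrite E p0 mul0r.
Qed.

Lemma specializes_cross f g h k a b c d : a != d -> b != c ->
  specializes f a -> specializes g b -> specializes h c -> specializes k d ->
  specializes (cross f g h k) (cross a b c d).
Proof.
move=> ad bc fa gb hc kd.
have specB f1 f2 z1 z2 : specializes f1 z1 -> specializes f2 z2 ->
    specializes (f1 - f2) (z1 - z2).
  by move=> ? ?; apply: specializesD => //; apply: specializesN.
by do !apply: specializesM; do ?apply: specializesV; rewrite ?subr_eq0 //;
  apply: specB.
Qed.

Lemma specializes_mmap (K : nzRingType) d
    (i : {rmorphism K -> {fraction R}}) (c : {rmorphism K -> F})
    (t : 'I_d -> {fraction R}) (z : 'I_d -> F) (p : {mpoly K[d]}) :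
  (forall a, specializes (i a) (c a)) ->
  (forall k, specializes (t k) (z k)) -> specializes (mmap i t p) (mmap c z p).
Proof.
move=> ic tz; apply: (big_ind2 specializes) => [||m _].
- by rewrite -tofrac0 -(rmorph0 e); apply: specializes_tofrac.
- by move=> *; apply: specializesD.
apply: specializesM => //; apply: (big_ind2 specializes) => [||k _].
- by rewrite -tofrac1 -(rmorph1 e); apply: specializes_tofrac.
- by move=> *; apply: specializesM.
elim: (m k) => [|r IHr]; last by rewrite !exprS; apply: specializesM.
by rewrite !expr0 -tofrac1 -(rmorph1 e); apply: specializes_tofrac.
Qed.

End Specialization.

(** * The action of the symmetric group *)

Section RationalFunctions.
Variables (K : fieldType) (n : nat).
Local Notation M := {fraction {mpoly K[n]}}.

Lemma cross_ratioE i j k l : cross_ratio K i j k l =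
  cross (ratX K i) (ratX K j) (ratX K k) (ratX K l) :> M.
Proof. by []. Qed.

Lemma ratX_inj : injective (@ratX K n).
Proof.
move=> i j /eqP; rewrite tofrac_eq => /eqP /(congr1 (mcoeff U_(i))).
rewrite !mcoeffX eqxx; case: eqP => [/mnmP/(_ i)|_ /eqP]; last first.
  by rewrite oner_eq0.
by rewrite !mnm1E eqxx; case: eqP.
Qed.

Definition mpoly_eval (F : fieldType) (c : {rmorphism K -> F}) (v : 'I_n -> F) :
  {rmorphism {mpoly K[n]} -> F} := mmap c v.

Lemma cross_ratio_specializes (F : fieldType) (c : {rmorphism K -> F})
    (v : 'I_n -> F) i j k l : v i != v l -> v j != v k ->
  specializes (mpoly_eval c v) (cross_ratio K i j k l)
    (cross (v i) (v j) (v k) (v l)).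
Proof.
have specX r : specializes (mpoly_eval c v) (ratX K r) (v r).
  rewrite -[X in specializes _ _ X](mmap1U v) -(mmapX v c).
  exact: (specializes_tofrac (mpoly_eval c v)).
by move=> il jk; apply: specializes_cross.
Qed.

(** Setting the variable of index [i'] equal to that of index [k'] turns the
    left side into 0 and fixes the right side, in which the former variable does
    not occur. *)
Lemma cross_ratio_neq (i j k l i' j' k' l' : 'I_n) :
  uniq [:: i; j; k; l] -> uniq [:: i'; j'; k'; l'] ->
  i' \notin [:: i; j; k; l] ->
  cross_ratio K i' j' k' l' <> cross_ratio K i j k l.
Proof.
move=> U U' i'N E; pose v r := ratX K (if r == i' then k' else r).
have vE r : r != i' -> v r = ratX K r by rewrite /v => /negPf->.
have vi' : v i' = v k' by rewrite /v eqxx; case: ifP.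
move: U U' i'N.
rewrite /= !inE !negb_or => /and4P[/and3P[ij ik il] /andP[jk jl] kl _].
move=> /and4P[/and3P[ij' ik' il'] /andP[jk' jl'] kl' _] /and4P[i'i i'j i'k i'l].
have [vi vj vk vl] : [/\ v i = ratX K i, v j = ratX K j,
    v k = ratX K k & v l = ratX K l].
  by rewrite !vE // eq_sym.
have [vj' vk' vl'] : [/\ v j' = ratX K j', v k' = ratX K k'
    & v l' = ratX K l'].
  by rewrite !vE // eq_sym.
have neqX (r s : 'I_n) : r != s -> ratX K r - ratX K s != 0.
  by rewrite subr_eq0 (inj_eq (@ratX_inj)).
have neqv r s : v r - v s != 0 -> v r != v s by rewrite subr_eq0.
have sp : specializes (mpoly_eval (ratC K n) v) (cross_ratio K i j k l)
    (cross (v i) (v j) (v k) (v l)).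
  apply: cross_ratio_specializes; apply: neqv.
    by rewrite vi vl; apply: neqX.
  by rewrite vj vk; apply: neqX.
have sp' : specializes (mpoly_eval (ratC K n) v) (cross_ratio K i' j' k' l')
    (cross (v i') (v j') (v k') (v l')).
  apply: cross_ratio_specializes; apply: neqv.
    by rewrite vi' vk' vl'; apply: neqX.
  by rewrite vj' vk'; apply: neqX.
rewrite E in sp'; have /esym/eqP := specializes_inj sp' sp.
rewrite /cross vi' subrr !mul0r vi vj vk vl; apply/negP.
by rewrite !mulf_neq0 ?invr_eq0 //; apply: neqX.
Qed.

Lemma cross_ratio_field_intermediate :
  intermediate_field (ratC K n) (cross_ratio_field K n).
Proof. exact: intermediate_field_adjoin. Qed.

Lemma cross_ratio_in_field i j k l :
  uniq [:: i; j; k; l] -> cross_ratio_field K n (cross_ratio K i j k l).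
Proof. by move=> U; apply: sub_adjoin; exists i, j, k, l. Qed.

Definition rat_automorphism (s : 'S_n) : {rmorphism M -> M} :=
  let: And3 sB sM _ := rat_action_automorphisms K s in
  HB.pack (fun x : M => rat_action K n x s)
    (GRing.isZmodMorphism.Build M M _ sB)
    (GRing.isMonoidMorphism.Build M M _ sM).

Lemma rat_automorphismE s x : rat_automorphism s x = rat_action K n x s.
Proof. by rewrite /rat_automorphism; case: rat_action_automorphisms. Qed.

Lemma rat_action_cross_ratio s i j k l :
  rat_action K n (cross_ratio K i j k l) s =
  cross_ratio K (s i) (s j) (s k) (s l).
Proof.
by rewrite -rat_automorphismE rmorph_cross !rat_automorphismE !rat_actionX.
Qed.

Lemma rat_action_cross_ratio_field s f :
  cross_ratio_field K n f -> cross_ratio_field K n (rat_action K n f s).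
Proof.
have [_ _ sC] := rat_action_automorphisms K s.
rewrite -rat_automorphismE.
apply: adjoin_stable => [c|_ [i [j [k [l [U ->]]]]]].
  by rewrite rat_automorphismE sC.
rewrite rat_automorphismE rat_action_cross_ratio; apply: cross_ratio_in_field.
by rewrite -(map_inj_uniq (@perm_inj _ s)) in U.
Qed.

Lemma cross_ratio_field_faithful : (5 <= n)%N ->
  faithful_G_subfield (ratC K n) (rat_action K n) (cross_ratio_field K n).
Proof.
move=> n5; split.
  split; first exact: cross_ratio_field_intermediate.
  by move=> s _ [f Lf <-]; apply: rat_action_cross_ratio_field.
move=> s s1.
have /existsP[i si] : [exists i, s i != i].
  apply: contraNT s1; rewrite negb_exists => /forallP s1.
  by apply/eqP/permP => i; rewrite perm1; apply/eqP; rewrite -[_ == _]negbK.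
(* As [5 <= n], three indices [j, k, l] remain besides [i] and [s i]. *)
have : (3 <= #|[set~ i] :\ s i|)%N.
  have := cardsD1 (s i) [set~ i]; rewrite cardsC1 card_ord !inE si => n1.
  by rewrite -(leq_add2l 1) -n1 ltn_predRL.
rewrite cardE; case E : (enum _) => [|j [|k [|l r]]] // _.
have: uniq [:: j, k, l & r] by rewrite -E enum_uniq.
have mem t : t \in [:: j; k; l] -> (t != s i) && (t != i).
  move=> tin; suff: t \in [set~ i] :\ s i by rewrite !inE.
  by rewrite -mem_enum E (mem_cat t [:: j; k; l] r) tin.
move=> /= /and4P[]; rewrite !inE !negb_or => /and3P[jk jl _] /andP[kl _] _ _.
have /andP[jsi ji] := mem j (mem_head _ _).
have /andP[ksi ki] : (k != s i) && (k != i).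
  by apply: mem; rewrite !inE eqxx orbT.
have /andP[lsi li] : (l != s i) && (l != i).
  by apply: mem; rewrite !inE eqxx !orbT.
have U : uniq [:: i; j; k; l].
  by rewrite /= !inE !negb_or jk jl kl !(eq_sym i) ji ki li.
exists (cross_ratio K i j k l); first exact: cross_ratio_in_field.
move/(etrans (esym (rat_action_cross_ratio s i j k l))).
apply: cross_ratio_neq => //.
  by rewrite -(map_inj_uniq (@perm_inj _ s)) in U.
by rewrite !inE !negb_or si !(eq_sym (s i)) jsi ksi lsi.
Qed.

End RationalFunctions.

(** * A transcendence basis *)

Section Generators.
Variables (K : fieldType) (d : nat).
Local Notation M := {fraction {mpoly K[3 + d]}}.

Definition frame_point (a : 'I_3) : 'I_(3 + d) := lshift d a.
Local Notation o := (frame_point (@Ordinal 3 0 isT)).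
Local Notation u := (frame_point (@Ordinal 3 1 isT)).
Local Notation v := (frame_point (@Ordinal 3 2 isT)).

Definition frame_cross_ratio (k : 'I_d) : M :=
  cross_ratio K o u v (rshift 3 k).

(** The homogeneous coordinates in the frame [o, u, v] are 0, 1 or one of the
    generators; by [cross_frame_det] every cross-ratio is a rational function of
    them. *)
Lemma cross_ratio_field_frame :
  cross_ratio_field K (3 + d) =
  adjoin (ratC K (3 + d)) (range frame_cross_ratio).
Proof.
have frame : uniq [:: o; u; v] by [].
apply/seteqP; split; apply: adjoin_sub; do ?exact: intermediate_field_adjoin.
  move=> _ [i [j [k [l [U ->]]]]].
  have := intermediate_field_adjoin (ratC K (3 + d)) (range frame_cross_ratio).
  have := @sub_adjoin _ _ (ratC K (3 + d)) (range frame_cross_ratio).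
  move: (adjoin _ _) => E gensE EE.
  have coordE r : E (frame_coord (@ratX K _) o u v r).1 /\
      E (frame_coord (@ratX K _) o u v r).2.
    have [E0 E1] := (intermediate_field0 EE, intermediate_field1 EE).
    case: (split_ordP r) => [a|k'] ->; last first.
      rewrite /frame_coord -val_eqE /=; split=> //.
      by apply: gensE; exists k'.
    have : [\/ lshift d a = o, lshift d a = u | lshift d a = v].
      case: a => [[|[|[|//]]] a3]; [apply: Or31|apply: Or32|apply: Or33];
        exact: val_inj.
    case=> ->; first by rewrite /frame_coord eqxx.
      by rewrite frame_coord_u.
    by rewrite frame_coord_v //; apply: ratX_inj.
  have detE r s : E (frame_det (@ratX K _) o u v r s).
    have [[r1 r2] [s1 s2]] := (coordE r, coordE s).
    by apply: (intermediate_fieldB EE); apply: (intermediate_fieldM EE).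
  rewrite cross_ratioE (cross_frame_det (@ratX_inj K _) frame U).
  have [_ _ ED] := EE.
  by apply: (ED) => //; apply: (ED) => //; apply: (intermediate_fieldM EE).
move=> _ [k _ <-]; exact: cross_ratio_in_field.
Qed.

(** The map [z |-> (s + z)^-1] sends infinity, 0 and 1 to [0], [s^-1] and
    [(s + 1)^-1].  Sending the first three variables to these values and the
    others to the images of the [inc 'X_k] makes each [frame_cross_ratio k]
    specialize to [inc 'X_k], by the invariance of cross-ratios. *)
Lemma frame_cross_ratio_specialization (F : fieldType)
    (inc : {rmorphism {mpoly K[d]} -> F}) (s : F) :
    (forall a, s + inc a != 0) ->
  exists w : 'I_(3 + d) -> F, forall k,
    specializes (mpoly_eval (inc \o @mpolyC d K) w)
      (frame_cross_ratio k) (inc 'X_k).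
Proof.
move=> s0.
(* The value that the cross-ratio with [o, u, v] is to take: 0 at [u], 1 at [v]
   and [inc 'X_k] at the index of [frame_cross_ratio k]. *)
pose y (i : 'I_(3 + d)) : F :=
  match fintype.split i with
  | inl a => (a == 2%N :> nat)%:R
  | inr k => inc 'X_k
  end.
pose w i : F := if i == o then 0 else (s + y i)^-1.
have wo : w o = 0 by rewrite /w eqxx.
have wE i : i != o -> w i = (s + y i)^-1 by rewrite /w => /negPf->.
have yu : y u = 0 by rewrite /y /frame_point (unsplitK (inl _)).
have yv : y v = 1 by rewrite /y /frame_point (unsplitK (inl _)).
have yX k : y (rshift 3 k) = inc 'X_k by rewrite /y (unsplitK (inr _)).
have wu : w u = s^-1 by rewrite wE // yu addr0.
have wv : w v = (s + 1)^-1 by rewrite wE // yv.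
have wX k : w (rshift 3 k) = (s + inc 'X_k)^-1 by rewrite wE // yX.
have su : s != 0 by have := s0 0; rewrite rmorph0 addr0.
have sv : s + 1 != 0 by have := s0 1; rewrite rmorph1.
exists w => k; have sX := s0 'X_k.
have -> : inc 'X_k = cross (w o) (w u) (w v) (w (rshift 3 k)).
  rewrite wo wu wv wX /cross; move: (inc _) sX => z sX.
  by field; rewrite sX sv su mulN1r addrAC subrr add0r oppr_eq0 !oner_eq0.
apply: cross_ratio_specializes; first by rewrite wo wX eq_sym invr_eq0.
rewrite wu wv (inj_eq invr_inj) -subr_eq0 opprD addrA subrr add0r.
by rewrite oppr_eq0 oner_neq0.
Qed.

Lemma frame_cross_ratio_independent :
  algebraically_independent (ratC K (3 + d)) frame_cross_ratio.
Proof.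
(* One extra variable serves as [s]: then [s + a] is nonzero for every [a] in
   the ring of the other variables. *)
pose P := {poly {mpoly K[d]}}; pose F := {fraction P}.
pose inc : {rmorphism {mpoly K[d]} -> F} := @FracField.tofrac P \o polyC.
pose c : {rmorphism K -> F} := inc \o @mpolyC d K.
have T0 a : @FracField.tofrac P 'X + inc a != 0.
  by rewrite /inc /= -tofracD tofrac_eq0 -size_poly_eq0 size_XaddC.
have [w spec] := frame_cross_ratio_specialization T0.
have specC a : specializes (mpoly_eval c w) (ratC K (3 + d) a) (c a).
  rewrite -(mmapC w c); exact: (specializes_tofrac (mpoly_eval c w)).
move=> p p0; have := specializes_mmap p specC spec.
rewrite p0 -(tofrac0 {mpoly K[3 + d]}) => sp0.
have /esym := specializes_inj (specializes_tofrac _ 0) sp0.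
rewrite mmap_rmorph.
by rewrite rmorph0 => /eqP; rewrite tofrac_eq0 polyC_eq0 => /eqP.
Qed.

End Generators.

(* The indices 1, 2, 3 and 4 <= i <= n are shifted down by one, 'I_n being
   {0, ..., n - 1}. *)
Theorem lemma3p1 (K : fieldType) (n : nat) (hn : (5 <= n)%N) :
  let L := cross_ratio_field K n in
  [/\ faithful_G_subfield (ratC K n) (rat_action K n) L,
      L = adjoin (ratC K n) [set z | exists i1 i2 i3 i : 'I_n,
            [/\ i1 = 0%N :> nat, i2 = 1%N :> nat, i3 = 2%N :> nat, (3 <= i)%N
              & z = cross_ratio K i1 i2 i3 i]]
    & purely_transcendental (ratC K n) L (n - 3)].
Proof.
move=> L; rewrite {}/L; split; first exact: cross_ratio_field_faithful.
all: case: n hn => [|[|[|d]]] // _.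
  apply: etrans (cross_ratio_field_frame K d) _; congr adjoin.
  apply/seteqP; split=> [_ [k _ <-]|_ [i1 [i2 [i3 [i [e1 e2 e3 i_ge3 ->]]]]]].
    by do 4!eexists; split; last reflexivity.
  have i_lt : (i - 3 < d)%N by rewrite ltn_subLR // ltn_ord.
  exists (Ordinal i_lt) => //; rewrite /frame_cross_ratio.
  by congr cross_ratio; apply: val_inj; rewrite /= ?subnKC.
rewrite subSS subSS subSS subn0; exists (@frame_cross_ratio K d); split.
  exact: frame_cross_ratio_independent.
exact: cross_ratio_field_frame.
Qed.
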